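(* Let $\gamma:\mathbb{S}^1\to\mathbb{R}$ have one-homogeneous extension $\gamma(\boldsymbol{p})$ and suppose $$3\gamma(\boldsymbol{n})>\gamma(-\boldsymbol{n})\quad\forall \boldsymbol{n}\in\mathbb{S}^1,\qquad \gamma(\boldsymbol{p})\in C^2(\mathbb{R}^2\setminus\{\boldsymbol{0}\}).$$ Let $k_0$ be the minimal stabilizing function of $\gamma$, and let $k:\mathbb{S}^1\to\mathbb{R}$ be a stabilizing function with $k(\boldsymbol{n})\ge k_0(\boldsymbol{n})$ for all $\boldsymbol{n}\in\mathbb{S}^1$. Let $\tau>0$, let $\boldsymbol{X}^0\in[\mathbb{K}^h]^2$ be given by $\boldsymbol{X}^0(\rho_j)=\boldsymbol{X}_0(\rho_j)$, $0\le j\le N$, for an initial closed curve $\boldsymbol{X}_0:\mathbb{T}\to\mathbb{R}^2$, and let $(\boldsymbol{X}^{m+1},\mu^{m+1})\in[\mathbb{K}^h]^2\times\mathbb{K}^h$, $m=0,1,2,\ldots$, satisfy the scheme (SP-PFEM for anisotropic curvature flow) $$\Bigl(\boldsymbol{n}^{m+\frac12}\cdot\frac{\boldsymbol{X}^{m+1}-\boldsymbol{X}^m}{\tau},\varphi^h\Bigr)^h_{\Gamma^m}+\Bigl(\mu^{m+1},\varphi^h\Bigr)^h_{\Gamma^m}=0\quad\forall\varphi^h\in\mathbb{K}^h,$$ $$\Bigl(\mu^{m+1}\boldsymbol{n}^{m+\frac12},\boldsymbol{\omega}^h\Bigr)^h_{\Gamma^m}-\Bigl(\boldsymbol{G}_k(\boldsymbol{n}^m)\partial_s\boldsymbol{X}^{m+1},\partial_s\boldsymbol{\omega}^h\Bigr)^h_{\Gamma^m}=0\quad\forall\boldsymbol{\omega}^h\in[\mathbb{K}^h]^2,$$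 where $\min_{1\le j\le N}|\boldsymbol{h}_j^m|>0$ for all $m\ge0$. Then $$\frac{A^{m+1}-A^m}{\tau}=-\Bigl(\mu^{m+1},1\Bigr)^h_{\Gamma^m},\qquad W^{m+1}\le W^m\le\cdots\le W^0,\qquad\forall m\ge0.$$
   Context: Rotation: for $\boldsymbol{v}=(v_1,v_2)^T\in\mathbb{R}^2$, $\boldsymbol{v}^\perp=(v_2,-v_1)^T$ (clockwise rotation by $\pi/2$). Anisotropy: the one-homogeneous extension of $\gamma$ is $\gamma(\boldsymbol{p})=|\boldsymbol{p}|\gamma(\boldsymbol{p}/|\boldsymbol{p}|)$ for $\boldsymbol{p}\ne\boldsymbol{0}$, $\gamma(\boldsymbol{0})=0$. The Cahn–Hoffman vector is $\boldsymbol{\xi}=\boldsymbol{\xi}(\boldsymbol{n})=\nabla\gamma(\boldsymbol{p})|_{\boldsymbol{p}=\boldsymbol{n}}$, $\boldsymbol{n}\in\mathbb{S}^1$. For a nonnegative function $k:\mathbb{S}^1\to\mathbb{R}$ (the stabilizing function), the surface energy matrix is $\boldsymbol{G}_k(\boldsymbol{n})=\gamma(\boldsymbol{n})I_2-\boldsymbol{n}\boldsymbol{\xi}^T+\boldsymbol{\xi}\boldsymbol{n}^T+k(\boldsymbol{n})\boldsymbol{n}\boldsymbol{n}^T$. Minimal stabilizing function: for $\boldsymbol{n},\hat{\boldsymbol{n}}\in\mathbb{S}^1$, $\alpha\ge0$, let $P_\alpha(\boldsymbol{n},\hat{\boldsymbol{n}})=2\sqrt{(\gamma(\boldsymbol{n})+\alpha(\hat{\boldsymbol{n}}\cdot\boldsymbol{n}^\perp)^2)\gamma(\boldsymbol{n})}$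 and $Q(\boldsymbol{n},\hat{\boldsymbol{n}})=\gamma(\hat{\boldsymbol{n}})+\gamma(\boldsymbol{n})(\boldsymbol{n}\cdot\hat{\boldsymbol{n}})-(\boldsymbol{\xi}(\boldsymbol{n})\cdot\boldsymbol{n}^\perp)(\hat{\boldsymbol{n}}\cdot\boldsymbol{n}^\perp)$. Then $k_0(\boldsymbol{n})=\inf\{\alpha\ge0:\ P_\alpha(\boldsymbol{n},\hat{\boldsymbol{n}})-Q(\boldsymbol{n},\hat{\boldsymbol{n}})\ge0\ \ \forall\hat{\boldsymbol{n}}\in\mathbb{S}^1\}$. Discretization: $\mathbb{T}=\mathbb{R}/\mathbb{Z}=[0,1]$ (periodic), $N>2$ an integer, $h=1/N$, $\rho_j=jh$ for $0\le j\le N$ (with $\rho_N=\rho_0$ by periodicity), $I_j=[\rho_{j-1},\rho_j]$. $\mathbb{K}^h=\{u\in C(\mathbb{T}):u|_{I_j}\text{ is a polynomial of degree}\le1,\ 1\le j\le N\}$. For $\boldsymbol{X}^m=(x^m,y^m)^T\in[\mathbb{K}^h]^2$, $\Gamma^m=\boldsymbol{X}^m(\mathbb{T})$ is a closed polygonal curve and $\boldsymbol{h}_j^m=\boldsymbol{X}^m(\rho_j)-\boldsymbol{X}^m(\rho_{j-1})$. The normal is the piecewise constant vector $\boldsymbol{n}^m|_{I_j}=\boldsymbol{n}_j^m=-(\boldsymbol{h}_j^m)^\perp/|\boldsymbol{h}_j^m|$, and $\boldsymbol{G}_k(\boldsymbol{n}^m)|_{I_j}=\boldsymbol{G}_k(\boldsymbol{n}_j^m)$.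 Further, $\boldsymbol{n}^{m+\frac12}=-\frac{1}{2|\partial_\rho\boldsymbol{X}^m|}(\partial_\rho\boldsymbol{X}^m+\partial_\rho\boldsymbol{X}^{m+1})^\perp$, i.e. $\boldsymbol{n}^{m+\frac12}|_{I_j}=-\frac{(\boldsymbol{h}_j^m+\boldsymbol{h}_j^{m+1})^\perp}{2|\boldsymbol{h}_j^m|}$. For scalar or vector functions $f$ on $\Gamma^m$, $\partial_sf|_{I_j}=\frac{f(\rho_j)-f(\rho_{j-1})}{|\boldsymbol{h}_j^m|}$. The mass-lumped inner product of (possibly discontinuous at the $\rho_j$) scalar or vector functions is $(u,v)^h_{\Gamma^m}=\frac12\sum_{j=1}^N|\boldsymbol{h}_j^m|\bigl((u\cdot v)(\rho_{j-1}^+)+(u\cdot v)(\rho_j^-)\bigr)$, with one-sided limits. Discrete area and energy: $A^m=\frac12\sum_{j=1}^N(x^m(\rho_j)-x^m(\rho_{j-1}))(y^m(\rho_j)+y^m(\rho_{j-1}))$, $W^m=\sum_{j=1}^N|\boldsymbol{h}_j^m|\gamma(\boldsymbol{n}_j^m)$. *)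

(* Defs.v *)
From HB Require Import structures.
From mathcomp Require Import all_boot all_order all_algebra.
From mathcomp Require Import all_classical all_reals all_analysis.

Set Implicit Arguments.
Unset Strict Implicit.
Unset Printing Implicit Defensive.

Import Order.TTheory GRing.Theory Num.Theory.
Import numFieldNormedType.Exports.

Local Open Scope classical_set_scope.
Local Open Scope ring_scope.

Section plane.
Variable R : realType.
Implicit Types (u v n p : 'cV[R]_2).

Definition dot u v : R := \sum_(i < 2) u i 0 * v i 0.

(* The library norm `|u| on matrices is the sup norm, hence this definition. *)
Definition enorm u : R := Num.sqrt (dot u u).

Definition perp v : 'cV[R]_2 :=
  \col_(i < 2) (if i == 0 then v 1 0 else - v 0 0).

Definition unit_circle : set 'cV[R]_2 := [set n | enorm n = 1].

Definition unit_vec (i : 'I_2) : 'cV[R]_2 := delta_mx i 0.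

(* f is of class C^k on the open set U: all partial derivatives up to order k
   exist and are continuous on U. *)
Fixpoint class_C (k : nat) (U : set 'cV[R]_2) (f : 'cV[R]_2 -> R) : Prop :=
  {in U, continuous f} /\
  if k is k'.+1 then
    forall i : 'I_2, {in U, forall p, derivable f p (unit_vec i)} /\
                     class_C k' U (fun p => 'D_(unit_vec i) f p)
  else True.

Definition gradient (f : 'cV[R]_2 -> R) p : 'cV[R]_2 :=
  \col_(i < 2) 'D_(unit_vec i) f p.

End plane.

(* Functions on the unit circle (gamma, k, k_0) are given by functions on the
   plane of which only the values on [unit_circle] are used. *)
Section anisotropy.
Variables (R : realType) (gamma : 'cV[R]_2 -> R).
Implicit Types (n nh p : 'cV[R]_2) (k : 'cV[R]_2 -> R).

Definition homogeneous_ext p : R :=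
  if p == 0 then 0 else enorm p * gamma ((enorm p)^-1 *: p).

Definition cahn_hoffman n : 'cV[R]_2 := gradient homogeneous_ext n.

Definition energy_matrix k n : 'M[R]_2 :=
  (gamma n)%:M - n *m (cahn_hoffman n)^T + cahn_hoffman n *m n^T
  + k n *: (n *m n^T).

Definition stab_P (alpha : R) n nh : R :=
  2 * Num.sqrt ((gamma n + alpha * dot nh (perp n) ^+ 2) * gamma n).

Definition stab_Q n nh : R :=
  gamma nh + gamma n * dot n nh
  - dot (cahn_hoffman n) (perp n) * dot nh (perp n).

(* [inf] is the real-valued infimum, 0 on the empty set; the set below is
   nonempty when gamma (- n) < 3 * gamma n on the circle and gamma is C^2. *)
Definition minimal_stabilizer n : R :=
  inf [set alpha : R | 0 <= alpha /\
        forall nh, unit_circle nh -> 0 <= stab_P alpha n nh - stab_Q n nh].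

End anisotropy.

(* Functions on the torus R/Z are 1-periodic functions on R. *)
Section discretization.
Variables (R : realType) (N : nat).
Implicit Types (u : R -> R) (X Y : R -> 'cV[R]_2) (j : nat).

Definition node j : R := j%:R * N%:R^-1.

Definition fe_space : set (R -> R) :=
  [set u | [/\ periodic u (1 : R), continuous u &
     forall j, (1 <= j <= N)%N ->
       exists2 p : {poly R}, (size p <= 2)%N &
         {in `[node j.-1, node j], forall rho, u rho = p.[rho]}]].

Definition fe_space2 : set (R -> 'cV[R]_2) :=
  [set X | forall i : 'I_2, fe_space (fun rho => X rho i 0)].

(* The 1-periodic function with value c j on the interior of the cell
   [node j.-1, node j], 1 <= j <= N; its values at the nodes are immaterial
   since only one-sided limits at the nodes are used below. *)
Definition piecewise (V : Type) (c : nat -> V) (rho : R) : V :=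
  c (Num.truncn (N%:R * (rho - (Num.floor rho)%:~R))).+1.

Definition edge X j : 'cV[R]_2 := X (node j) - X (node j.-1).

Definition edge_normal X j : 'cV[R]_2 :=
  - ((enorm (edge X j))^-1 *: perp (edge X j)).

Definition normal X : R -> 'cV[R]_2 := piecewise (edge_normal X).

(* n^{m+1/2} for X = X^m and Y = X^{m+1} *)
Definition half_normal X Y : R -> 'cV[R]_2 :=
  piecewise (fun j =>
    - ((2 * enorm (edge X j))^-1 *: perp (edge X j + edge Y j))).

(* arclength derivative of Y on the polygon X *)
Definition partial_s X Y : R -> 'cV[R]_2 :=
  piecewise (fun j => (enorm (edge X j))^-1 *: (Y (node j) - Y (node j.-1))).

Definition lumped_sum X (w : R -> R) : R :=
  2^-1 * \sum_(1 <= j < N.+1) enorm (edge X j) *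
    (lim (w rho @[rho --> (node j.-1)^'+]) + lim (w rho @[rho --> (node j)^'-])).

Definition lumped X (u v : R -> R) : R :=
  lumped_sum X (fun rho => u rho * v rho).

Definition lumped2 X (U V : R -> 'cV[R]_2) : R :=
  lumped_sum X (fun rho => dot (U rho) (V rho)).

Definition area X : R :=
  2^-1 * \sum_(1 <= j < N.+1)
    (X (node j) 0 0 - X (node j.-1) 0 0) * (X (node j) 1 0 + X (node j.-1) 1 0).

Definition energy (gamma : 'cV[R]_2 -> R) X : R :=
  \sum_(1 <= j < N.+1) enorm (edge X j) * gamma (edge_normal X j).

(* One time step of the scheme, from X = X^m to (Y, mu) = (X^{m+1}, mu^{m+1}). *)
Definition scheme_step (gamma k : 'cV[R]_2 -> R) (tau : R) X Y (mu : R -> R) :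
    Prop :=
  (forall phi, fe_space phi ->
     lumped X (fun rho => dot (half_normal X Y rho) (tau^-1 *: (Y rho - X rho)))
              phi
     + lumped X mu phi = 0) /\
  (forall omega, fe_space2 omega ->
     lumped2 X (fun rho => mu rho *: half_normal X Y rho) omega
     - lumped2 X
         (fun rho => energy_matrix gamma k (normal X rho) *m partial_s X Y rho)
         (partial_s X omega) = 0).

End discretization.

(* Main.v *)
(** Testing the first equation with [mu] and the second with [X m.+1 - X m] gives
    that the stiffness term equals [- tau * lumped (X m) mu mu <= 0].  Edge by edge
    the stiffness term dominates the energy increment, by AM-GM, as soon as
    [stab_Q gamma n nh <= stab_P gamma (k n) n nh] on the circle.  The latter
    follows from [minimal_stabilizer gamma n <= k n], provided the set of which the
    minimal stabilizer is the infimum is nonempty.  That is where the hypotheses on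
    [gamma] enter: they give
    [stab_Q gamma n nh <= 2 * gamma n + K * dot nh (perp n) ^+ 2] for some [K].
    The area law is the first equation tested with the constant [1]. *)

Require Import Defs.
From mathcomp Require Import all_boot all_order all_algebra.
From mathcomp Require Import all_classical all_reals all_analysis.
From mathcomp Require Import ring lra.
Import Order.TTheory GRing.Theory Num.Theory.
Import numFieldNormedType.Exports.
Local Open Scope classical_set_scope.
Local Open Scope ring_scope.
Set Implicit Arguments.
Unset Strict Implicit.

(** * Plane vectors and the surface energy matrix *)

Lemma dot2E {R : realType} (u v : 'cV[R]_2) :
  dot u v = u 0 0 * v 0 0 + u 1 0 * v 1 0.
Proof.
rewrite /dot big_ord_recl big_ord_recl big_ord0 addr0.
have ord1E : lift ord0 ord0 = 1 :> 'I_2 by apply/val_inj.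
by rewrite ord1E.
Qed.

Lemma sqr_enorm {R : realType} (u : 'cV[R]_2) :
  enorm u ^+ 2 = u 0 0 ^+ 2 + u 1 0 ^+ 2.
Proof. by rewrite sqr_sqrtr dot2E -!expr2 // addr_ge0 // sqr_ge0. Qed.

Lemma unit_circleP {R : realType} (n : 'cV[R]_2) :
  unit_circle n <-> n 0 0 ^+ 2 + n 1 0 ^+ 2 = 1.
Proof.
rewrite /unit_circle /= -sqr_enorm; split=> [->|n1]; first by rewrite expr1n.
by apply/eqP; rewrite -(eqrXn2 (n := 2)) ?sqrtr_ge0 // n1 expr1n.
Qed.

Lemma homogeneous_ext_unit {R : realType} (gamma : 'cV[R]_2 -> R) (n : 'cV[R]_2) :
  unit_circle n -> homogeneous_ext gamma n = gamma n.
Proof.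
rewrite /homogeneous_ext; case: eqP => [->|_] n1; last by rewrite n1 mul1r invr1 scale1r.
by move/unit_circleP: n1 => /esym; rewrite !mxE !expr0n addr0 => /eqP; rewrite oner_eq0.
Qed.

Lemma mul_outer_mx {R : realType} (a b u : 'cV[R]_2) :
  a *m b^T *m u = dot b u *: a.
Proof.
rewrite -mulmxA; have -> : b^T *m u = (dot b u)%:M.
  apply/matrixP => i j; rewrite (ord1 i) (ord1 j) !mxE mulr1n.
  by apply: eq_bigr => l _; rewrite mxE.
by rewrite mul_mx_scalar.
Qed.

Lemma dot_energy_matrix {R : realType} (gamma k : 'cV[R]_2 -> R) (n u v : 'cV[R]_2) :
  dot (energy_matrix gamma k n *m u) v =
  gamma n * dot u v - dot n v * dot (cahn_hoffman gamma n) u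
  + dot (cahn_hoffman gamma n) v * dot n u + k n * (dot n u * dot n v).
Proof.
rewrite /energy_matrix !mulmxDl mulNmx -scalemxAl !mul_outer_mx mul_scalar_mx.
by rewrite !(dot2E _ v) !mxE; ring.
Qed.

Lemma col2P {R : realType} (u v : 'cV[R]_2) :
  u 0 0 = v 0 0 -> u 1 0 = v 1 0 -> u = v.
Proof.
move=> uv0 uv1; apply/matrixP => i j; rewrite (ord1 j).
case: i => -[|[|//]] i2.
- by rewrite (_ : Ordinal i2 = 0) //; apply/val_inj.
- by rewrite (_ : Ordinal i2 = 1) //; apply/val_inj.
Qed.

(** * Edge normals and the energy estimate on one edge *)

Lemma edge_normal_unit {R : realType} (N : nat) (X : R -> 'cV[R]_2) (j : nat) :
  0 < enorm (edge N X j) -> unit_circle (edge_normal N X j).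
Proof.
rewrite /edge_normal; move: (edge N X j) => e L0; apply/unit_circleP.
rewrite !mxE /=.
have -> : (- ((enorm e)^-1 * e 1 0)) ^+ 2 + (- ((enorm e)^-1 * - e 0 0)) ^+ 2
          = enorm e ^- 2 * (e 0 0 ^+ 2 + e 1 0 ^+ 2) by rewrite -exprVn; ring.
by rewrite -sqr_enorm mulVf // expf_neq0 // gt_eqF.
Qed.

(** Applying [perp] twice is negation, which cancels the sign in [edge_normal]. *)
Lemma edge_perp_normal {R : realType} (N : nat) (X : R -> 'cV[R]_2) (j : nat) :
  0 < enorm (edge N X j) ->
  edge N X j = enorm (edge N X j) *: perp (edge_normal N X j).
Proof.
rewrite /edge_normal; move: (edge N X j) => e L0.
have L1 : enorm e != 0 by rewrite gt_eqF.
by apply: col2P; rewrite !mxE /=; field.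
Qed.

(* AM-GM on [M ^+ 2 / L * (gamma n + k n * s ^+ 2)] and [L * gamma n], where
   [s = dot nh (perp n)], produces [M * stab_P (k n) n nh]. *)
Lemma local_energy_estimate {R : realType} (gamma k : 'cV[R]_2 -> R)
    (n nh : 'cV[R]_2) (L M : R) :
  unit_circle nh -> 0 < L -> 0 <= M -> 0 <= gamma n -> 0 <= k n ->
  stab_Q gamma n nh <= stab_P gamma (k n) n nh ->
  M * gamma nh - L * gamma n <=
  L * dot (energy_matrix gamma k n *m (L^-1 *: (M *: perp nh)))
          (L^-1 *: (M *: perp nh - L *: perp n)).
Proof.
move=> /unit_circleP nh1 L0 M0 g0 k0 QP.
have L1 : L != 0 by rewrite gt_eqF.
set s := dot nh (perp n).
set a := gamma n + k n * s ^+ 2.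
have a0 : 0 <= a by rewrite addr_ge0 // mulr_ge0 // sqr_ge0.
(* In the part quadratic in [M] the [cahn_hoffman] terms cancel by antisymmetry. The part linear in
   [M] is [stab_Q] without its term [gamma nh], because [dot n (perp n) = 0]. *)
suff -> : L * dot (energy_matrix gamma k n *m (L^-1 *: (M *: perp nh)))
              (L^-1 *: (M *: perp nh - L *: perp n))
    = M ^+ 2 / L * a - M * (stab_Q gamma n nh - gamma nh).
  have : M * stab_P gamma (k n) n nh <= M ^+ 2 / L * a + L * gamma n.
    rewrite /stab_P -/s -/a sqrtrM //.
    have := sqr_ge0 (M / L * Num.sqrt a - Num.sqrt (gamma n)).
    move=> /(mulr_ge0 (ltW L0)).
    set p := Num.sqrt a; set q := Num.sqrt (gamma n).
    have -> : a = p ^+ 2 by rewrite sqr_sqrtr.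
    have -> : gamma n = q ^+ 2 by rewrite sqr_sqrtr.
    have -> : L * (M / L * p - q) ^+ 2
      = M ^+ 2 / L * p ^+ 2 + L * q ^+ 2 - M * (2 * (p * q)) by field.
    by rewrite subr_ge0.
  have : M * stab_Q gamma n nh <= M * stab_P gamma (k n) n nh by rewrite ler_wpM2l.
  lra.
rewrite dot_energy_matrix /a /s /stab_Q !dot2E.
move: (cahn_hoffman gamma n) => xi; rewrite !mxE /=.
set x := nh 0 0 in nh1 *; set y := nh 1 0 in nh1 *.
(* This form keeps [x ^+ 2 + y ^+ 2] visible, so that [nh1] can replace it by [1]. *)
transitivity (M ^+ 2 / L * (gamma n * (x ^+ 2 + y ^+ 2)
   + k n * (x * n 1 0 + y * - n 0 0) ^+ 2)
  - M * (gamma n * (n 0 0 * x + n 1 0 * y)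
     - (xi 0 0 * n 1 0 + xi 1 0 * - n 0 0)
        * (x * n 1 0 + y * - n 0 0))); first by field.
by rewrite nh1; ring.
Qed.

(** * Cells, mass lumping and the finite element spaces *)

(** The open cell lies in the first period, so the floor vanishes and [N * rho] has integer part
    [j.-1]; the successor in [piecewise] restores [j]. *)
Lemma piecewise_cell {R : realType} (N : nat) (V : Type) (c : nat -> V) (j : nat)
    (rho : R) :
  (1 <= j <= N)%N -> rho \in `]node R N j.-1, node R N j[ ->
  piecewise N c rho = c j.
Proof.
case: j => [//|j] /= jN; rewrite in_itv /= /node => /andP[lo hi].
have N0 : 0 < N%:R :> R by rewrite ltr0n (leq_trans _ jN).
rewrite ltr_pdivrMr // in lo; rewrite ltr_pdivlMr // in hi.
have fl : Num.floor rho = 0.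
  apply: floor_def; apply/andP; split.
    by rewrite -(pmulr_rge0 _ N0) mulrC (le_trans _ (ltW lo)).
  by rewrite add0r -(ltr_pM2r N0) mul1r (lt_le_trans hi) // ler_nat.
rewrite /piecewise fl subr0; congr (c _.+1); apply: truncn_def.
by rewrite mulrC (ltW lo) hi.
Qed.

Lemma node_lt {R : realType} (N j : nat) :
  (1 <= j <= N)%N -> node R N j.-1 < node R N j.
Proof.
case: j => [//|j] /= jN.
by rewrite ltr_pM2r ?ltr_nat // invr_gt0 ltr0n (leq_trans _ jN).
Qed.

(** One-sided limits at the ends of a cell only see its interior. There [w] agrees with a function
    [v j] continuous on the whole line, whose limits are its values at the nodes. *)
Lemma lumped_sumE {R : realType} (N : nat) (X : R -> 'cV[R]_2) (w : R -> R)
    (v : nat -> R -> R) :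
  (forall j, (1 <= j <= N)%N -> continuous (v j)) ->
  (forall j, (1 <= j <= N)%N ->
     {in `]node R N j.-1, node R N j[, forall rho, w rho = v j rho}) ->
  lumped_sum N X w = 2^-1 * \sum_(1 <= j < N.+1) enorm (edge N X j) *
    (v j (node R N j.-1) + v j (node R N j)).
Proof.
move=> vc wv; congr (_ * _); apply: eq_big_nat => j jN.
have jlt := node_lt (R := R) jN.
congr (_ * (_ + _)); apply: cvg_lim => //.
- apply: cvg_trans (cvg_at_right_filter (vc j jN _)).
  apply: near_eq_cvg; near=> rho; apply/esym/wv => //.
  by rewrite in_itv /=; apply/andP; split; near: rho;
    [exact: nbhs_right_gt|exact: nbhs_right_lt].
- apply: cvg_trans (cvg_at_left_filter (vc j jN _)).
  apply: near_eq_cvg; near=> rho; apply/esym/wv => //.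
  by rewrite in_itv /=; apply/andP; split; near: rho;
    [exact: nbhs_left_gt|exact: nbhs_left_lt].
Unshelve. all: by end_near.
Qed.

Lemma fe_space_cst {R : realType} (N : nat) (c : R) : fe_space N (fun _ => c).
Proof.
split=> // [x|j _]; first exact: cvg_cst.
exists c%:P => [|rho _]; last by rewrite hornerC.
by rewrite (leq_trans (size_polyC_leq1 _)).
Qed.

Lemma fe_spaceB {R : realType} (N : nat) (u v : R -> R) :
  fe_space N u -> fe_space N v -> fe_space N (fun rho => u rho - v rho).
Proof.
move=> [up uc ul] [vp vc vl]; split=> [x|x|j jN].
- by rewrite up vp.
- by apply: cvgB; [exact: uc|exact: vc].
have [p ps pu] := ul j jN; have [q qs qv] := vl j jN.
exists (p - q) => [|rho rhoj]; last by rewrite hornerD hornerN pu // qv.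
by rewrite (leq_trans (size_polyD _ _)) // size_polyN geq_max ps.
Qed.

Lemma fe_space2B {R : realType} (N : nat) (X Y : R -> 'cV[R]_2) :
  fe_space2 N X -> fe_space2 N Y -> fe_space2 N (fun rho => X rho - Y rho).
Proof.
move=> Xf Yf i.
rewrite (_ : (fun _ => _) = fun rho => X rho i 0 - Y rho i 0).
  exact: fe_spaceB.
by apply/funext => rho; rewrite !mxE.
Qed.

Lemma fe_space2_periodic {R : realType} (N : nat) (X : R -> 'cV[R]_2) :
  (0 < N)%N -> fe_space2 N X -> X (node R N N) = X (node R N 0).
Proof.
move=> N0 Xf; apply/matrixP => i j; rewrite (ord1 j) /node mul0r divff.
  by have [Xp _ _] := Xf i; rewrite -{1}[1]add0r Xp.
by rewrite pnatr_eq0 -lt0n.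
Qed.

Lemma continuous_dot {R : realType} (U V : R -> 'cV[R]_2) :
  (forall i, continuous (fun rho => U rho i 0)) ->
  (forall i, continuous (fun rho => V rho i 0)) ->
  continuous (fun rho => dot (U rho) (V rho)).
Proof.
move=> Uc Vc; rewrite (_ : (fun _ => _) =
   fun rho => U rho 0 0 * V rho 0 0 + U rho 1 0 * V rho 1 0); last first.
  by apply/funext => rho; rewrite dot2E.
by move=> x; apply: cvgD; apply: cvgM; [exact: Uc|exact: Vc|exact: Uc|exact: Vc].
Qed.

(** * The terms of the scheme as sums over edges, and the area increment *)

Definition half_edge_normal {R : realType} (N : nat) (X Y : R -> 'cV[R]_2) (j : nat) :=
  - ((2 * enorm (edge N X j))^-1 *: perp (edge N X j + edge N Y j)).

(** With [tau^-1] pulled out and [phi] equal to [mu], the sum is that of [lumped_potentialE] for [W]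
    equal to [Y - X]; this links the two equations of the scheme. *)
Lemma lumped_velocityE {R : realType} (N : nat) (tau : R) (X Y : R -> 'cV[R]_2)
    (phi : R -> R) :
  fe_space2 N X -> fe_space2 N Y -> fe_space N phi ->
  lumped N X (fun rho => dot (half_normal N X Y rho) (tau^-1 *: (Y rho - X rho))) phi
  = tau^-1 * (2^-1 * \sum_(1 <= j < N.+1) enorm (edge N X j) *
     (phi (node R N j.-1) * dot (half_edge_normal N X Y j)
         (Y (node R N j.-1) - X (node R N j.-1))
     + phi (node R N j) * dot (half_edge_normal N X Y j)
         (Y (node R N j) - X (node R N j)))).
Proof.
move=> Xf Yf [_ phic _].
rewrite /lumped (@lumped_sumE _ N X _ (fun j rho => tau^-1 * (phi rho *
  dot (half_edge_normal N X Y j) (Y rho - X rho)))).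
- rewrite [RHS]mulrCA; congr (_ * _); rewrite big_distrr /=; apply: eq_bigr => j _.
  by ring.
- move=> j _ x; apply: cvgM; first exact: cvg_cst.
  apply: cvgM; first exact: phic.
  apply: continuous_dot => i; first by move=> ?; exact: cvg_cst.
  by have [_] := fe_space2B Yf Xf i.
- move=> j jN rho rhoj; rewrite /half_normal (@piecewise_cell _ _ _ _ _ _ jN rhoj).
  by rewrite !dot2E !mxE; ring.
Qed.

Lemma lumped_potentialE {R : realType} (N : nat) (X Y W : R -> 'cV[R]_2)
    (mu : R -> R) :
  fe_space2 N W -> fe_space N mu ->
  lumped2 N X (fun rho => mu rho *: half_normal N X Y rho) W
  = 2^-1 * \sum_(1 <= j < N.+1) enorm (edge N X j) *
     (mu (node R N j.-1) * dot (half_edge_normal N X Y j) (W (node R N j.-1))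
     + mu (node R N j) * dot (half_edge_normal N X Y j) (W (node R N j))).
Proof.
move=> Wf [_ muc _].
rewrite /lumped2 (@lumped_sumE _ N X _
  (fun j rho => mu rho * dot (half_edge_normal N X Y j) (W rho))) //.
- move=> j _ x; apply: cvgM; first exact: muc.
  apply: continuous_dot => i; first by move=> ?; exact: cvg_cst.
  by have [] := Wf i.
- move=> j jN rho rhoj; rewrite /half_normal (@piecewise_cell _ _ _ _ _ _ jN rhoj).
  by rewrite !dot2E !mxE; ring.
Qed.

Lemma lumpedE {R : realType} (N : nat) (X : R -> 'cV[R]_2) (u v : R -> R) :
  continuous u -> continuous v ->
  lumped N X u v = 2^-1 * \sum_(1 <= j < N.+1) enorm (edge N X j) *
    (u (node R N j.-1) * v (node R N j.-1) + u (node R N j) * v (node R N j)).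
Proof.
move=> uc vc; rewrite /lumped (@lumped_sumE _ N X _ (fun _ rho => u rho * v rho)) //.
by move=> j _ x; apply: cvgM; [exact: uc|exact: vc].
Qed.

(** All factors are constant on a cell, so the two one-sided limits agree and absorb the factor
    [2^-1]. *)
Lemma lumped_stiffnessE {R : realType} (N : nat) (gamma k : 'cV[R]_2 -> R)
    (X Y W : R -> 'cV[R]_2) :
  lumped2 N X
    (fun rho => energy_matrix gamma k (normal N X rho) *m partial_s N X Y rho)
    (partial_s N X W)
  = \sum_(1 <= j < N.+1) enorm (edge N X j) *
      dot (energy_matrix gamma k (edge_normal N X j)
             *m ((enorm (edge N X j))^-1 *: edge N Y j))
          ((enorm (edge N X j))^-1 *: edge N W j).
Proof.
rewrite /lumped2 (@lumped_sumE _ N X _ (fun j _ =>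
      dot (energy_matrix gamma k (edge_normal N X j)
             *m ((enorm (edge N X j))^-1 *: edge N Y j))
          ((enorm (edge N X j))^-1 *: edge N W j))).
- rewrite big_distrr /=; apply: eq_bigr => j _; set d := dot _ _.
  by have -> : d + d = 2 * d; [ring|rewrite mulrCA mulKf].
- by move=> j _ x; exact: cvg_cst.
- by move=> j jN rho rhoj; rewrite /normal /partial_s !(@piecewise_cell _ _ _ _ _ _ jN rhoj).
Qed.

(* In each summand the area increment and the swept area differ by the increment
   of [2^-1 * (x' - x) * (y' + y)], which telescopes around the closed polygon. *)
Lemma area_increment {R : realType} (N : nat) (X Y : R -> 'cV[R]_2) :
  (0 < N)%N -> X (node R N N) = X (node R N 0) -> Y (node R N N) = Y (node R N 0) ->
  (forall j, (1 <= j <= N)%N -> 0 < enorm (edge N X j)) ->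
  area N Y - area N X = 2^-1 * \sum_(1 <= j < N.+1) enorm (edge N X j) *
     (dot (half_edge_normal N X Y j) (Y (node R N j.-1) - X (node R N j.-1))
     + dot (half_edge_normal N X Y j) (Y (node R N j) - X (node R N j))).
Proof.
move=> N0 XN YN L0; rewrite /area -mulrBr; congr (_ * _); apply/eqP.
rewrite -subr_eq0 -!sumrB; apply/eqP.
pose F j := (Y (node R N j) 0 0 - X (node R N j) 0 0)
            * (Y (node R N j) 1 0 + X (node R N j) 1 0).
transitivity (\sum_(1 <= j < N.+1) (F j - F j.-1)).
  apply: eq_big_nat => j /L0; rewrite /half_edge_normal.
  have -> : edge N Y j = Y (node R N j) - Y (node R N j.-1) by [].
  have -> : enorm (edge N X j) = enorm (edge N X j) * 1 by rewrite mulr1.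
  move: (enorm _) => L; rewrite mulr1 => Lj; rewrite /F /edge !dot2E.
  rewrite !mxE /=.
  have Ln : L != 0 by rewrite gt_eqF.
  by field.
by rewrite big_add1 /= telescope_sumr // /F XN YN subrr.
Qed.

(** * Energy decay in one time step *)

Lemma energy_step_le {R : realType} (gamma k : 'cV[R]_2 -> R) (N : nat) (tau : R)
    (X Y : R -> 'cV[R]_2) (mu : R -> R) :
  (forall n, unit_circle n -> 0 < gamma n) ->
  (forall n, unit_circle n -> 0 <= k n) ->
  (forall n nh, unit_circle n -> unit_circle nh ->
     stab_Q gamma n nh <= stab_P gamma (k n) n nh) ->
  0 < tau -> fe_space2 N X -> fe_space2 N Y -> fe_space N mu ->
  scheme_step N gamma k tau X Y mu ->
  (forall j, (1 <= j <= N)%N -> 0 < enorm (edge N X j)) ->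
  (forall j, (1 <= j <= N)%N -> 0 < enorm (edge N Y j)) ->
  energy N gamma Y <= energy N gamma X.
Proof.
move=> g0 k0 QP tau0 Xf Yf muf [velocity potential] LX LY.
have Df := fe_space2B Yf Xf.
have [_ muc _] := muf.
have := potential _ Df; rewrite lumped_potentialE // lumped_stiffnessE.
have := velocity _ muf; rewrite lumped_velocityE //.
(* [S] is common to both tested equations: [vel] gives [tau^-1 * S = - lumped N X mu mu], and [pot]
   equates [S] with the stiffness term. *)
set S := 2^-1 * _ => vel /eqP; rewrite subr_eq0 => /eqP pot.
have mu2 : 0 <= lumped N X mu mu.
  rewrite lumpedE // mulr_ge0 ?invr_ge0 // big_nat_cond sumr_ge0 // => j.
  rewrite andbT => jN; rewrite mulr_ge0 ?(ltW (LX j jN)) //.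
  by rewrite addr_ge0 // -expr2 sqr_ge0.
have S0 : S <= 0.
  by rewrite -(pmulr_rle0 S (_ : 0 < tau^-1)) ?invr_gt0 //; lra.
rewrite -subr_le0 (le_trans _ S0) // pot /energy -sumrB.
rewrite ler_sum_nat // => j jN.
have e : edge N (fun rho => Y rho - X rho) j = edge N Y j - edge N X j.
  by apply/matrixP => i l; rewrite /edge !mxE; ring.
have nX := edge_normal_unit (LX j jN); have nY := edge_normal_unit (LY j jN).
(* Here [L], [n] come from the edge of [X] and [M], [nh] from that of [Y]; the rotated normals then
   fold back into the edges. *)
have := local_energy_estimate nY (LX j jN) (ltW (LY j jN)) (ltW (g0 _ nX))
  (k0 _ nX) (QP _ _ nX nY).
by rewrite -(edge_perp_normal (LX j jN)) -(edge_perp_normal (LY j jN)) e.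
Qed.

(** * Second-order Taylor bound from partial derivatives *)

(** The one-variable mean value theorem on a line parallel to an axis. Locating [s] by absolute
    values covers both signs of [t]. *)
Lemma MVT_unit_vec {R : realType} (f : 'cV[R]_2 -> R) (i : 'I_2) (p : 'cV[R]_2)
    (t : R) :
  (forall s, `|s| <= `|t| -> derivable f (s *: unit_vec R i + p) (unit_vec R i)) ->
  exists2 s, `|s| <= `|t| &
    f (t *: unit_vec R i + p) - f p
    = t * 'D_(unit_vec R i) f (s *: unit_vec R i + p).
Proof.
move=> fd; set e := unit_vec R i in fd *.
pose phi (s : R) : R := f (s *: e + p).
pose dphi (s : R) : R := 'D_e f (s *: e + p).
have phid (s : R) : `|s| <= `|t| -> is_derive s (1 : R) phi (dphi s).
  (* The difference quotients of [phi] and of [f] along [e] are the same function, so derivability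
     and derivative both transfer. *)
  move=> st; have eqd : (fun h : R => h^-1 *: (phi (h *: (1 : R) + s) - phi s))
      = (fun h : R => h^-1 *: (f (h *: e + (s *: e + p)) - f (s *: e + p))).
    by apply/funext => h; rewrite /phi addrA -scalerDl [h *: (1 : R)]mulr1.
  have phiE : derivable phi s (1 : R) by rewrite /derivable eqd; exact: fd.
  by apply: DeriveDef => //; rewrite /dphi /derive eqd.
have mvt a b : a <= b -> `|a| <= `|t| -> `|b| <= `|t| ->
    exists2 c, `|c| <= `|t| & phi b - phi a = dphi c * (b - a).
  move=> ab at_ bt.
  have abt c : c \in `[a, b] -> `|c| <= `|t|.
    by rewrite in_itv /= ler_norml; move: at_ bt; rewrite !ler_norml; lra.
  have [||c cab cE] := @MVT_segment R phi dphi a b ab; last by exists c => //; exact: abt.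
  - by move=> c /subset_itv_oo_cc cab; exact/phid/abt.
  - apply: derivable_within_continuous => c cab.
    by suff /phid[] : `|c| <= `|t| by []; exact: abt.
have phi0 : phi 0 = f p by rewrite /phi scale0r add0r.
have [t0|/ltW t0] := leP 0 t.
- have [||s st] := mvt 0 t t0; rewrite ?normr0 // subr0 phi0 mulrC => fE.
  by exists s.
- have [||s st] := mvt t 0 t0; rewrite ?normr0 // sub0r phi0 mulrN => fE.
  by exists s => //; rewrite -/(dphi s) mulrC -[RHS]opprK -fE opprB.
Qed.

(** This distance is the length of an axis-parallel path, along which increments are controlled by
    partial derivatives alone. *)
Definition l1dist {R : realType} (p q : 'cV[R]_2) : R :=
  `|q 0 0 - p 0 0| + `|q 1 0 - p 1 0|.

Lemma l1dist_ge0 {R : realType} (p q : 'cV[R]_2) : 0 <= l1dist p q.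
Proof. by rewrite addr_ge0. Qed.

(** The topology on matrices comes from the sup norm, which the l1 norm dominates. *)
Lemma nbhs_l1dist {R : realType} (p : 'cV[R]_2) (P : set 'cV[R]_2) :
  nbhs p P -> exists2 d : R, 0 < d & forall q, l1dist p q < d -> P q.
Proof.
move=> /nbhs_ballP[d /= d0 dP]; exists d => // q pq; apply: dP; split=> // i j.
rewrite (ord1 j) /ball /= distrC; apply: le_lt_trans pq; rewrite /l1dist.
case: i => -[|[|//]] i2.
- by rewrite (_ : Ordinal i2 = 0) ?lerDl //; apply/val_inj.
- by rewrite (_ : Ordinal i2 = 1) ?lerDr //; apply/val_inj.
Qed.

(** From [n] go to the corner [r] along the first axis, then to [q] along the second, and apply the
    mean value theorem on each leg. No point of the path is farther from [n] than [q]. *)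
Lemma increment_partials {R : realType} (f : 'cV[R]_2 -> R) (n q : 'cV[R]_2) (d : R) :
  (forall z i, l1dist n z < d -> derivable f z (unit_vec R i)) ->
  l1dist n q < d ->
  exists z0 z1, [/\ l1dist n z0 <= l1dist n q, l1dist n z1 <= l1dist n q &
    f q - f n = (q 0 0 - n 0 0) * 'D_(unit_vec R 0) f z0
                + (q 1 0 - n 1 0) * 'D_(unit_vec R 1) f z1].
Proof.
move=> fd nq; set a := q 0 0 - n 0 0; set b := q 1 0 - n 1 0.
pose r := a *: unit_vec R 0 + n.
have l0 s : `|s| <= `|a| -> l1dist n (s *: unit_vec R 0 + n) <= l1dist n q.
  move=> sa; rewrite /l1dist !mxE /= -/a -/b mulr1 mulr0 add0r subrr normr0 addr0.
  by rewrite addrK ler_wpDr.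
have l1 s : `|s| <= `|b| -> l1dist n (s *: unit_vec R 1 + r) <= l1dist n q.
  move=> sb; rewrite /l1dist !mxE /= -/a -/b !mulr1 !mulr0 !add0r !addrK.
  by rewrite lerD2l.
have [s sa sE] := @MVT_unit_vec R f 0 n a (fun s sa => fd _ _ (le_lt_trans (l0 s sa) nq)).
have [u ub uE] := @MVT_unit_vec R f 1 r b (fun s sb => fd _ _ (le_lt_trans (l1 s sb) nq)).
exists (s *: unit_vec R 0 + n), (u *: unit_vec R 1 + r); split; [exact: l0|exact: l1|].
rewrite -sE -uE -/r [RHS]addrC addrA subrK; congr (f _ - _).
by apply: col2P; rewrite !mxE /= /a /b ?mulr0 ?mulr1 ?add0r subrK.
Qed.

Lemma lipschitz_partials {R : realType} (f : 'cV[R]_2 -> R) (n q : 'cV[R]_2) (d C : R) :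
  (forall z i, l1dist n z < d -> derivable f z (unit_vec R i)) ->
  (forall z i, l1dist n z < d -> `|'D_(unit_vec R i) f z| <= C) ->
  l1dist n q < d -> `|f q - f n| <= C * l1dist n q.
Proof.
move=> fd fC nq; have [z0 [z1 [z0q z1q ->]]] := increment_partials fd nq.
rewrite (le_trans (ler_normD _ _)) // !normrM /l1dist mulrDr.
by rewrite lerD // mulrC ler_wpM2r // fC // (le_lt_trans _ nq).
Qed.

(** Removing the linear term from [increment_partials] leaves each coordinate increment times the
    variation of a partial derivative, at most [C * l1dist n q]; the increments add up to the second
    factor [l1dist n q]. *)
Lemma taylor2_partials {R : realType} (f : 'cV[R]_2 -> R) (n q : 'cV[R]_2) (d C : R) :
  0 <= C ->
  (forall z i, l1dist n z < d -> derivable f z (unit_vec R i)) ->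
  (forall z i, l1dist n z < d ->
     `|'D_(unit_vec R i) f z - 'D_(unit_vec R i) f n| <= C * l1dist n z) ->
  l1dist n q < d ->
  f q <= f n + dot (gradient f n) (q - n) + C * l1dist n q ^+ 2.
Proof.
move=> C0 fd fC nq; have [z0 [z1 [z0q z1q fE]]] := increment_partials fd nq.
have D z i : l1dist n z <= l1dist n q ->
    `|'D_(unit_vec R i) f z - 'D_(unit_vec R i) f n| <= C * l1dist n q.
  by move=> zq; rewrite (le_trans (fC _ _ (le_lt_trans zq nq))) // ler_wpM2l.
move: (D z0 0 z0q) (D z1 1 z1q) fE.
have <- : gradient f n 0 0 = 'D_(unit_vec R 0) f n by rewrite mxE.
have <- : gradient f n 1 0 = 'D_(unit_vec R 1) f n by rewrite mxE.
rewrite dot2E; move: ('D__ f z0) ('D__ f z1) (gradient f n) (f q) (f n).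
move=> a b g fq fn aC bC fE; rewrite -lerBlDl !mxE.
have -> : fq - (fn + (g 0 0 * (q 0 0 - n 0 0) + g 1 0 * (q 1 0 - n 1 0)))
  = (q 0 0 - n 0 0) * (a - g 0 0) + (q 1 0 - n 1 0) * (b - g 1 0).
  by rewrite opprD addrA fE; ring.
rewrite (le_trans (ler_norm _)) // (le_trans (ler_normD _ _)) // !normrM.
rewrite expr2 {2}/l1dist mulrA mulrDr.
by rewrite lerD // mulrC ler_wpM2r.
Qed.

Lemma ler_term_sum2 {R : realType} (I : finType) (F : I -> I -> R) (i j : I) :
  (forall i j, 0 <= F i j) -> F i j <= \sum_i \sum_j F i j.
Proof.
move=> F0; have Fi0 l : 0 <= \sum_j F l j by rewrite sumr_ge0.
apply: (@le_trans _ _ (\sum_l F i l)).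
  by rewrite (bigD1 j) //= lerDl sumr_ge0.
by rewrite [leRHS](bigD1 i) //= lerDl sumr_ge0.
Qed.

(** Second partials are continuous, hence bounded near [n], so the first partials satisfy the
    Lipschitz condition of [taylor2_partials]. *)
Lemma class_C2_taylor {R : realType} (f : 'cV[R]_2 -> R) (U : set 'cV[R]_2)
    (n : 'cV[R]_2) :
  class_C 2 U f -> nbhs n U -> exists C d : R, [/\ 0 <= C, 0 < d &
    forall q, l1dist n q < d ->
      f q <= f n + dot (gradient f n) (q - n) + C * l1dist n q ^+ 2].
Proof.
move=> [_ fC2] nU.
have Un : n \in U by rewrite inE; exact: nbhs_singleton.
pose D2 i j := 'D_(unit_vec R j) ('D_(unit_vec R i) f).
(* The summand [1] leaves room for each second partial to vary near [n]. *)
pose C := \sum_i \sum_j (`|D2 i j n| + 1).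
have termC i j : `|D2 i j n| + 1 <= C.
  by apply: (ler_term_sum2 (F := fun i j => `|D2 i j n| + 1)) => *; rewrite addr_ge0.
have C0 : 0 <= C by rewrite (le_trans _ (termC 0 0)) // addr_ge0.
have : \forall q \near n, U q /\ forall i j, `|D2 i j q| <= C.
  near=> q; split; first by near: q.
  move=> i j; apply/ltW/(lt_le_trans _ (termC i j)); move: i j; near: q.
  apply: filter_forall => i; apply: filter_forall => j.
  have [_ [_ fC1]] := fC2 i; have [_ [/(_ n Un) fc _]] := fC1 j.
  by apply: (cvgr_norm_lt _ fc); rewrite ltrDl.
move=> /nbhs_l1dist[d d0 dP]; exists C, d; split=> // q nq.
apply: (taylor2_partials C0 _ _ nq) => z i nz.
- by have [fd _] := fC2 i; apply: fd; rewrite inE; exact: (dP z nz).1.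
- have [_ [_ fC1]] := fC2 i.
  apply: (@lipschitz_partials _ ('D_(unit_vec R i) f) n z d C) => // y j ny.
    by have [fd _] := fC1 j; apply: fd; rewrite inE; exact: (dP y ny).1.
  exact: ((dP y ny).2 i j).
Unshelve. all: by end_near.
Qed.

(** * Boundedness and trigonometry on the unit circle *)

Lemma cvg_col2 {R : realType} (u v : R -> R) (x : R) :
  {for x, continuous u} -> {for x, continuous v} ->
  {for x, continuous (fun y => \col_(i < 2) (if i == 0 then u y else v y))}.
Proof.
move=> uc vc P /nbhs_ballP[e /= e0 eP].
have ux : \forall y \near x, ball (u x) e (u y) by apply: uc; exact: nbhsx_ballx.
have vx : \forall y \near x, ball (v x) e (v y) by apply: vc; exact: nbhsx_ballx.
apply: filterS2 ux vx => y uy vy; apply: eP; split=> // i j; rewrite !mxE.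
by case: ifP.
Qed.

Lemma unit_circle_neq0 {R : realType} (n : 'cV[R]_2) : unit_circle n -> n != 0.
Proof.
move=> /unit_circleP n1; apply/eqP => n0; move: n1.
by rewrite n0 !mxE expr0n addr0 => /esym/eqP; rewrite oner_eq0.
Qed.

Lemma unit_circleN {R : realType} (n : 'cV[R]_2) : unit_circle n -> unit_circle (- n).
Proof. by move=> /unit_circleP n1; apply/unit_circleP; rewrite !mxE !sqrrN. Qed.

(** The circle is the union of two graphs over [[-1, 1]], and the extreme value theorem applies to
    [f] along each of them. *)
Lemma unit_circle_ub {R : realType} (f : 'cV[R]_2 -> R) :
  (forall n, unit_circle n -> {for n, continuous f}) ->
  exists M, forall n, unit_circle n -> f n <= M.
Proof.
move=> fc.
pose g (e x : R) := \col_(i < 2) (if i == 0 then x else e * Num.sqrt (1 - x ^+ 2)).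
have g1 e x : e ^+ 2 = 1 -> x \in `[-1, 1] -> unit_circle (g e x).
  move=> e1; rewrite in_itv /= -ler_norml => x1.
  apply/unit_circleP; rewrite !mxE /= exprMn e1 mul1r sqr_sqrtr; first by ring.
  by rewrite subr_ge0 -real_normK ?num_real // expr_le1.
have half e : e ^+ 2 = 1 -> exists M, forall x, x \in `[-1, 1] -> f (g e x) <= M.
  move=> e1; have [| |c _ cM] := @EVT_max R (f \o g e) (-1) 1; last by exists (f (g e c)).
  - by lra.
  - apply: continuous_in_subspaceT => x /set_mem x1.
    apply: continuous_comp; last exact/fc/g1.
    apply: cvg_col2; first exact: cvg_id.
    have sc : Num.sqrt (1 - y ^+ 2) @[y --> x] --> Num.sqrt (1 - x ^+ 2).
      have h : (1 - y ^+ 2) @[y --> x] --> (1 - x ^+ 2).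
        by apply: cvgB; [exact: cvg_cst|exact: exprn_continuous].
      exact: (cvg_comp _ _ h (@sqrt_continuous R _)).
    exact: (cvgM (cvg_cst e) sc).
have [M1 M1P] := half 1 (expr1n _ _).
have [M2 M2P] := half (-1) (etrans (sqrrN _) (expr1n _ _)).
exists (Num.max M1 M2) => n n1.
have n01 : n 0 0 \in `[-1, 1].
  move/unit_circleP: n1 => n1; rewrite in_itv /= -ler_norml.
  by rewrite -(@expr_le1 _ 2) // real_normK ?num_real // -n1 lerDl sqr_ge0.
have sn : Num.sqrt (1 - n 0 0 ^+ 2) = `|n 1 0|.
  by move/unit_circleP: n1 => <-; rewrite addrAC subrr add0r sqrtr_sqr.
rewrite le_max; have [ge0|lt0] := leP 0 (n 1 0).
- rewrite (_ : n = g 1 (n 0 0)) ?M1P //.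
  by apply: col2P; rewrite !mxE //= sn mul1r ger0_norm.
- rewrite orbC (_ : n = g (-1) (n 0 0)) ?M2P //.
  by apply: col2P; rewrite !mxE //= sn mulN1r ltr0_norm // opprK.
Qed.

(** Lagrange's identity: the squared sine of the angle is [(1 - cos) * (1 + cos)]. The factors
    vanish at [nh = n] and [nh = - n] respectively. *)
Lemma dot_perp_unit {R : realType} (n nh : 'cV[R]_2) :
  unit_circle n -> unit_circle nh ->
  dot nh (perp n) ^+ 2 = (1 - dot n nh) * (1 + dot n nh).
Proof.
move=> /unit_circleP n1 /unit_circleP nh1; rewrite !dot2E !mxE /=.
transitivity ((n 0 0 ^+ 2 + n 1 0 ^+ 2) * (nh 0 0 ^+ 2 + nh 1 0 ^+ 2)
  - (n 0 0 * nh 0 0 + n 1 0 * nh 1 0) ^+ 2); first by ring.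
by rewrite n1 nh1; ring.
Qed.

Lemma dot_unit_le1 {R : realType} (n nh : 'cV[R]_2) :
  unit_circle n -> unit_circle nh -> dot n nh <= 1.
Proof.
move=> /unit_circleP n1 /unit_circleP nh1; rewrite dot2E.
have := sqr_ge0 (n 0 0 - nh 0 0); have := sqr_ge0 (n 1 0 - nh 1 0); nra.
Qed.

(** The squared Euclidean distance is [2 * (1 - dot n nh)], and the squared l1 norm lies between
    once and twice the squared Euclidean norm. *)
Lemma l1dist_unit {R : realType} (n nh : 'cV[R]_2) :
  unit_circle n -> unit_circle nh ->
  2 * (1 - dot n nh) <= l1dist n nh ^+ 2 <= 4 * (1 - dot n nh).
Proof.
move=> /unit_circleP n1 /unit_circleP nh1; rewrite /l1dist dot2E.
set a := nh 0 0 - n 0 0; set b := nh 1 0 - n 1 0.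
have a2 : `|a| ^+ 2 = a ^+ 2 by rewrite real_normK ?num_real.
have b2 : `|b| ^+ 2 = b ^+ 2 by rewrite real_normK ?num_real.
have ab : a ^+ 2 + b ^+ 2 = 2 * (1 - (n 0 0 * nh 0 0 + n 1 0 * nh 1 0)).
  have -> : a ^+ 2 + b ^+ 2 = (nh 0 0 ^+ 2 + nh 1 0 ^+ 2) + (n 0 0 ^+ 2 + n 1 0 ^+ 2)
     - 2 * (n 0 0 * nh 0 0 + n 1 0 * nh 1 0) by rewrite /a /b; ring.
  by rewrite n1 nh1; ring.
have p : 0 <= `|a| * `|b| by rewrite mulr_ge0.
have := sqr_ge0 (`|a| - `|b|).
rewrite sqrrB sqrrD a2 b2 mulr2n; lra.
Qed.

(** Expansion in the orthonormal frame [n], [perp n]. For the Cahn-Hoffman vector the last term is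
    the one subtracted in [stab_Q]. *)
Lemma dot_rotation_frame {R : realType} (n nh xi : 'cV[R]_2) :
  unit_circle n ->
  dot xi (nh - n) = (dot n nh - 1) * dot xi n + dot nh (perp n) * dot xi (perp n).
Proof.
move=> /unit_circleP n1; rewrite !dot2E !mxE /=.
transitivity ((xi 0 0 * nh 0 0 + xi 1 0 * nh 1 0) * (n 0 0 ^+ 2 + n 1 0 ^+ 2)
  - (xi 0 0 * n 0 0 + xi 1 0 * n 1 0)); first by rewrite n1; ring.
ring.
Qed.

(** * Comparison of [stab_Q] with [stab_P] *)

(** The condition at [n] and at [- n] gives [gamma n < 9 * gamma n]. *)
Lemma ratio_gt0 {R : realType} (gamma : 'cV[R]_2 -> R) (n : 'cV[R]_2) :
  (forall n : 'cV[R]_2, unit_circle n -> gamma (- n) < 3 * gamma n) ->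
  unit_circle n -> 0 < gamma n.
Proof.
move=> ratio n1; have := ratio _ n1; have := ratio _ (unit_circleN n1).
by rewrite opprK; lra.
Qed.

Lemma continuous_stab_Q {R : realType} (f : 'cV[R]_2 -> R) (a b : R)
    (n p : 'cV[R]_2) :
  {for p, continuous f} ->
  {for p, continuous (fun q => f q + (a * dot n q - b * dot q (perp n)))}.
Proof.
move=> fc.
have dotc u : {for p, continuous (fun q => dot q u)}.
  rewrite (_ : (fun _ => _) = fun q : 'cV[R]_2 => q 0 0 * u 0 0 + q 1 0 * u 1 0); last first.
    by apply/funext => q; rewrite dot2E.
  have coordc i : q i 0 * u i 0 @[q --> p] --> p i 0 * u i 0.
    exact: (cvgM (@coord_continuous R 2 1 i 0 p) (cvg_cst (u i 0))).
  exact: (cvgD (coordc 0) (coordc 1)).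
rewrite (_ : (fun _ => _) = fun q : 'cV[R]_2 => f q + (a * dot q n - b * dot q (perp n))).
  exact: (cvgD fc (cvgB (cvgM (cvg_cst a) (dotc n)) (cvgM (cvg_cst b) (dotc (perp n))))).
by apply/funext => q; rewrite !dot2E (mulrC (n 0 0)) (mulrC (n 1 0)).
Qed.

(* Taylor's formula gives the bound near [n], [gamma (- n) < 3 * gamma n] and
   continuity give it near [- n], and away from [n] and [- n] the last factor is
   bounded below while [stab_Q] is bounded above. *)
Lemma stab_Q_quadratic_bound {R : realType} (gamma : 'cV[R]_2 -> R) (n : 'cV[R]_2) :
  (forall n : 'cV[R]_2, unit_circle n -> gamma (- n) < 3 * gamma n) ->
  class_C 2 [set p : 'cV[R]_2 | p != 0] (homogeneous_ext gamma) ->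
  unit_circle n ->
  exists2 K : R, 0 <= K & forall nh, unit_circle nh ->
    stab_Q gamma n nh <= 2 * gamma n + K * dot nh (perp n) ^+ 2.
Proof.
move=> ratio fC2 n1.
set f := homogeneous_ext gamma in fC2; set xi := cahn_hoffman gamma n.
have fE p : unit_circle p -> f p = gamma p by exact: homogeneous_ext_unit.
have fc p : unit_circle p -> {for p, continuous f}.
  by move=> p1; apply: fC2.1; rewrite inE /=; exact: unit_circle_neq0.
have g0 : 0 < gamma n := ratio_gt0 ratio n1.
(* The extension [f] replaces [gamma], which is only controlled on the circle; [f] is continuous off
   the origin. *)
pose Q q := f q + (gamma n * dot n q - dot xi (perp n) * dot q (perp n)).
have QE q : unit_circle q -> stab_Q gamma n q = Q q.
  by move=> q1; rewrite /stab_Q /Q fE // addrA.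
have Qc p : unit_circle p -> {for p, continuous Q}.
  by move=> p1; apply: continuous_stab_Q; exact: fc.
have nbhsn : nbhs n [set p : 'cV[R]_2 | p != 0].
  exact: (cvgr_neq0 n (@cvg_id _ (nbhs n)) (unit_circle_neq0 n1)).
have [C [d1 [C0 d10 taylor]]] := class_C2_taylor fC2 nbhsn.
(* [Q (- n)] equals [gamma (- n) - gamma n], so this is exactly the ratio condition. *)
have QNn : Q (- n) < 2 * gamma n.
  rewrite /Q fE; last exact: unit_circleN.
  have -> : dot n (- n) = -1.
    by rewrite dot2E !mxE; move/unit_circleP: n1 => <-; ring.
  have -> : dot (- n) (perp n) = 0 by rewrite dot2E !mxE /=; ring.
  by have := ratio _ n1; lra.
have [d2 d20 nearNn] : exists2 d2 : R, 0 < d2 &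
    forall q, l1dist (- n) q < d2 -> Q q < 2 * gamma n.
  apply: nbhs_l1dist; exact: (cvgr_lt _ (Qc _ (unit_circleN n1))).
have [M QM] := unit_circle_ub Qc.
(* Away from [n] and [- n], [D] bounds the product of the squared distances to them from below; that
   product is at most [16 * dot q (perp n) ^+ 2]. *)
pose D := Num.min d1 1 ^+ 2 * d2 ^+ 2.
have d3 : 0 < Num.min d1 1 by rewrite lt_min d10 ltr01.
have D0 : 0 < D by rewrite mulr_gt0 // exprn_gt0.
(* [K1] serves the Taylor bound near [n], [K2] the region away from both points; both are
   nonnegative, so their sum serves everywhere. *)
pose K1 := `|dot xi n| + 4 * C; pose K2 := `|M| * 16 / D.
have K10 : 0 <= K1 by rewrite addr_ge0 // mulr_ge0.
have K20 : 0 <= K2 by rewrite divr_ge0 ?mulr_ge0 // ltW.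
exists (K1 + K2); first exact: addr_ge0.
move=> q q1; rewrite QE //.
have sE := dot_perp_unit n1 q1; have s0 := sqr_ge0 (dot q (perp n)).
have /andP[lo hi] := l1dist_unit n1 q1.
have /andP[_ hiN] := l1dist_unit (unit_circleN n1) q1.
have c1 := dot_unit_le1 n1 q1.
have cN : dot (- n) q = - dot n q by rewrite !dot2E !mxE; ring.
rewrite cN opprK in hiN.
set s2 := dot q (perp n) ^+ 2 in sE s0 *; set c := dot n q in sE lo hi hiN c1 *.
have K1s : 0 <= K1 * s2 by rewrite mulr_ge0.
have K2s : 0 <= K2 * s2 by rewrite mulr_ge0.
rewrite mulrDl.
have [nq|nq] := ltP (l1dist n q) (Num.min d1 1).
  move: nq; rewrite lt_min => /andP[nq lt1].
  have l1 : l1dist n q ^+ 2 < 1 by rewrite expr_lt1 ?l1dist_ge0.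
  (* By [lo] and [l1], [1 - c] is below one half, so the factor [1 + c] of [s2] exceeds [1]. This is
     the purpose of the minimum with [1]. *)
  have cs : 1 - c <= s2.
    by rewrite sE ler_peMr; lra.
  have tq : f q <= f n + dot xi (q - n) + C * l1dist n q ^+ 2 := taylor _ nq.
  (* The first-order term along [perp n] now cancels against the one in [Q]; all other errors are
     multiples of [1 - c]. *)
  rewrite (dot_rotation_frame _ _ n1) -/c (fE n n1) in tq.
  have b1 : (c - 1) * dot xi n <= `|dot xi n| * (1 - c).
    rewrite -opprB mulNr -mulrN mulrC ler_wpM2r ?subr_ge0 //.
    by rewrite -normrN ler_norm.
  have b2 : C * l1dist n q ^+ 2 <= C * (4 * (1 - c)) by rewrite ler_wpM2l.
  have b3 : gamma n * c <= gamma n by rewrite ler_piMr // ltW.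
  have b4 : K1 * (1 - c) <= K1 * s2 by rewrite ler_wpM2l.
  have K1E : K1 * (1 - c) = `|dot xi n| * (1 - c) + C * (4 * (1 - c)).
    by rewrite /K1; ring.
  rewrite /Q -/c; lra.
have [nNq|nNq] := ltP (l1dist (- n) q) d2.
  by have := nearNn _ nNq; lra.
have Ds : D <= 16 * s2.
  have -> : 16 * s2 = (4 * (1 - c)) * (4 * (1 + c)) by rewrite sE; ring.
  apply: ler_pM; rewrite ?sqr_ge0 //.
    by apply: le_trans hi; rewrite lerXn2r ?nnegrE ?l1dist_ge0 // ltW.
  by apply: le_trans hiN; rewrite lerXn2r ?nnegrE ?l1dist_ge0 // ltW.
have MK : M <= K2 * s2.
  have -> : K2 * s2 = `|M| * (16 * s2) / D by rewrite /K2; ring.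
  by rewrite (le_trans (ler_norm M)) // ler_pdivlMr // ler_wpM2l.
by have := QM _ q1; lra.
Qed.

(** Halve and square both sides. The chosen [alpha] makes the right side equal to the left one with
    [s2] in place of [s2 ^+ 2], and [s2 <= 1]. *)
Lemma stab_P_quadratic_bound {R : realType} (gamma : 'cV[R]_2 -> R) (n nh : 'cV[R]_2)
    (K : R) :
  0 < gamma n -> 0 <= K -> unit_circle n -> unit_circle nh ->
  2 * gamma n + K * dot nh (perp n) ^+ 2
  <= stab_P gamma (K + K ^+ 2 / (4 * gamma n)) n nh.
Proof.
move=> g0 K0 n1 nh1; rewrite /stab_P.
have s1 : dot nh (perp n) ^+ 2 <= 1.
  rewrite dot_perp_unit // -subr_sqr expr1n lerBlDl lerDr; exact: sqr_ge0.
have s0 := sqr_ge0 (dot nh (perp n)).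
move: (dot nh (perp n) ^+ 2) s1 s0 => s2 s1 s0.
have -> : 2 * gamma n + K * s2 = 2 * (gamma n + K * s2 / 2) by field.
rewrite ler_pM2l // -[leLHS]ger0_norm; last first.
  by rewrite addr_ge0 ?divr_ge0 ?mulr_ge0 // ltW.
rewrite -sqrtr_sqr ler_wsqrtr //.
have -> : (gamma n + (K + K ^+ 2 / (4 * gamma n)) * s2) * gamma n
    = gamma n ^+ 2 + gamma n * K * s2 + K ^+ 2 / 4 * s2.
  by field; rewrite gt_eqF.
have -> : (gamma n + K * s2 / 2) ^+ 2
    = gamma n ^+ 2 + gamma n * K * s2 + K ^+ 2 / 4 * s2 ^+ 2 by field.
by rewrite lerD2l ler_wpM2l ?divr_ge0 ?sqr_ge0 // expr2 ler_piMr.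
Qed.

(** For fixed [nh] with [stab_Q] positive and [s2] nonzero, the inequality defining [E] says
    [beta <= alpha], a closed condition that passes to the infimum and hence to [k n]. *)
Lemma stab_Q_le_stab_P {R : realType} (gamma k : 'cV[R]_2 -> R) (n nh : 'cV[R]_2) :
  (forall n : 'cV[R]_2, unit_circle n -> gamma (- n) < 3 * gamma n) ->
  class_C 2 [set p : 'cV[R]_2 | p != 0] (homogeneous_ext gamma) ->
  (forall n : 'cV[R]_2, unit_circle n -> minimal_stabilizer gamma n <= k n) ->
  unit_circle n -> 0 <= k n -> unit_circle nh ->
  stab_Q gamma n nh <= stab_P gamma (k n) n nh.
Proof.
move=> ratio fC2 kk0 n1 kn0 nh1; have g0 := ratio_gt0 ratio n1.
have [K K0 KQ] := stab_Q_quadratic_bound ratio fC2 n1.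
set E := [set alpha : R | 0 <= alpha /\
  forall nh, unit_circle nh -> 0 <= stab_P gamma alpha n nh - stab_Q gamma n nh].
(* Without a member of [E], [inf] would take its default value [0] and bound nothing. *)
have En0 : E !=set0.
  exists (K + K ^+ 2 / (4 * gamma n)); split.
    by rewrite addr_ge0 // divr_ge0 ?sqr_ge0 // mulr_ge0 // ltW.
  move=> q q1; rewrite subr_ge0 (le_trans (KQ _ q1)) //.
  exact: stab_P_quadratic_bound.
rewrite leNgt; apply/negP => PQ.
set s2 := dot nh (perp n) ^+ 2.
have s0 : 0 <= s2 by exact: sqr_ge0.
have Qgt0 : 0 < stab_Q gamma n nh by apply: le_lt_trans PQ; rewrite mulr_ge0 ?sqrtr_ge0.
have PE alpha : 0 <= alpha -> stab_P gamma alpha n nh ^+ 2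
    = 4 * gamma n * (gamma n + alpha * s2).
  move=> a0; rewrite exprMn sqr_sqrtr; first by rewrite /s2; ring.
  exact: (mulr_ge0 (addr_ge0 (ltW g0) (mulr_ge0 a0 s0)) (ltW g0)).
have P0 alpha : 0 <= stab_P gamma alpha n nh by rewrite mulr_ge0 ?sqrtr_ge0.
have PQ2 : 4 * gamma n * (gamma n + k n * s2) < stab_Q gamma n nh ^+ 2.
  by rewrite -PE // ltrXn2r ?nnegrE ?(ltW Qgt0).
have EQ2 alpha : E alpha -> stab_Q gamma n nh ^+ 2 <= 4 * gamma n * (gamma n + alpha * s2).
  move=> [a0 /(_ nh nh1)]; rewrite subr_ge0 => QP.
  by rewrite -PE // lerXn2r ?nnegrE ?(ltW Qgt0).
have [a Ea] := En0.
(* If [s2 = 0], [stab_P] does not depend on [alpha], so any member of [E] contradicts [PQ2]. *)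
have s2gt0 : 0 < s2.
  rewrite lt_neqAle s0 andbT; apply/eqP => s20.
  by have := lt_le_trans PQ2 (EQ2 a Ea); rewrite -s20 !mulr0 ltxx.
(* [beta] solves [4 * gamma n * (gamma n + beta * s2) = stab_Q gamma n nh ^+ 2]. *)
pose beta := (stab_Q gamma n nh ^+ 2 / (4 * gamma n) - gamma n) / s2.
have g4 : 0 < 4 * gamma n by rewrite mulr_gt0.
have betaE : beta <= k n.
  apply: le_trans (kk0 n n1); apply: lb_le_inf => // b Eb.
  by rewrite ler_pdivrMr // lerBlDl ler_pdivrMr // [leRHS]mulrC; exact: EQ2.
have := betaE; rewrite leNgt => /negP; apply.
by rewrite ltr_pdivlMr // ltrBrDl ltr_pdivlMr // [ltLHS]mulrC.
Qed.

(** * Area law and energy decay along the scheme *)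

Unset Implicit Arguments.
Set Strict Implicit.

Theorem theorem4p1 (R : realType) (gamma k : 'cV[R]_2 -> R) (N : nat) (tau : R)
    (X0 : R -> 'cV[R]_2) (X : nat -> R -> 'cV[R]_2) (mu : nat -> R -> R)
    (gamma_ratio : forall n : 'cV[R]_2, unit_circle n ->
       gamma (- n) < 3 * gamma n)
    (gamma_C2 : class_C 2 [set p : 'cV[R]_2 | p != 0] (homogeneous_ext gamma))
    (k_ge0 : forall n : 'cV[R]_2, unit_circle n -> 0 <= k n)
    (k_ge_k0 : forall n : 'cV[R]_2, unit_circle n ->
       minimal_stabilizer gamma n <= k n)
    (N_gt2 : (2 < N)%N)
    (tau_gt0 : 0 < tau)
    (X0_closed : periodic X0 (1 : R))
    (X0_cont : continuous X0)
    (X_fe : forall m : nat, fe_space2 N (X m))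
    (mu_fe : forall m : nat, fe_space N (mu m.+1))
    (X_init : forall j : nat, (j <= N)%N -> X 0%N (node R N j) = X0 (node R N j))
    (X_scheme : forall m : nat,
       scheme_step N gamma k tau (X m) (X m.+1) (mu m.+1))
    (X_nondeg : forall m j : nat, (1 <= j <= N)%N -> 0 < enorm (edge N (X m) j)) :
  forall m : nat,
    (area N (X m.+1) - area N (X m)) / tau
      = - lumped N (X m) (mu m.+1) (fun _ => 1)
    /\ (forall l : nat, (l <= m)%N ->
          energy N gamma (X l.+1) <= energy N gamma (X l)).
Proof.
have g0 n : unit_circle n -> 0 < gamma n by exact: ratio_gt0.
have N0 : (0 < N)%N by rewrite (ltn_trans _ N_gt2).
move=> m; split.
  have [velocity _] := X_scheme m.
  have := velocity _ (fe_space_cst N 1).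
  rewrite lumped_velocityE //; last exact: fe_space_cst.
  under eq_bigr do rewrite !mul1r.
  rewrite -area_increment //; first last.
  - exact: X_nondeg.
  - exact: fe_space2_periodic.
  - exact: fe_space2_periodic.
  by move=> /eqP; rewrite addr_eq0 mulrC => /eqP.
move=> l _; apply: (energy_step_le g0 k_ge0 _ tau_gt0 (X_fe l) (X_fe l.+1) (mu_fe l)
  (X_scheme l) (X_nondeg l) (X_nondeg l.+1)).
by move=> n nh n1 nh1; apply: stab_Q_le_stab_P => //; exact: k_ge0.
Qed.
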